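(* Let $X$ be a real Banach space and let $(\Omega,\Sigma,\mu)$ be a $\sigma$-finite measure space with $\mu(\Omega)>0$. Then $X$ has the property $( ** )$ if and only if $L_1(\mu,X)$ has the property $( ** )$.
   Context: All Banach spaces are real. For a Banach space $Z$, $B_Z$, $S_Z$ and $Z^*$ denote its closed unit ball, unit sphere and dual. For $z^*\in S_{Z^*}$ and $0<\alpha<1$, the slice is $S(z^*,\alpha)=\{z\in B_Z: z^*(z)>1-\alpha\}$, and $-S(z^*,\alpha)=\{-z: z\in S(z^*,\alpha)\}$. A Banach space $Z$ has the property $( ** )$ if for all $z_1,z_2\in S_Z$ and every $\varepsilon>0$ there exists $z^*\in S_{Z^*}$ such that, writing $S=S(z^*,\varepsilon)$, one has $z_1\in S$ and $\operatorname{dist}(z_2,S)+\operatorname{dist}(z_2,-S)<2+\varepsilon$. $L_1(\mu,X)$ is the Banach space of (classes of) Bochner-integrable functions $\Omega\to X$ with norm $\|f\|_1=\int_\Omega\|f(t)\|\,d\mu(t)$. *)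

(* Defs.v *)
From HB Require Import structures.
From mathcomp Require Import all_boot all_order all_algebra.
From mathcomp Require Import all_classical all_reals all_analysis.
Set Implicit Arguments. Unset Strict Implicit. Unset Printing Implicit Defensive.
Import Order.TTheory GRing.Theory Num.Theory.
Import numFieldNormedType.Exports.
Local Open Scope classical_set_scope.
Local Open Scope ring_scope.

(** A seminormed (sub)space: a subspace [A] of an lmodType [V] with a
    seminorm [N].  Normed spaces are the case [A = setT], [N = norm];
    L_1(mu, X) is the case of Bochner integrable functions with the L1
    seminorm (working with representatives instead of a.e.-classes does
    not change any of the notions below, since norm-one functionals
    vanish on null elements and distances only depend on N). *)
Section SeminormedSubspace.
Variables (R : realType) (V : lmodType R) (A : set V) (N : V -> R).

Definition dual_sphere (f : V -> R) : Prop :=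
  [/\ (forall (a : R) x y, A x -> A y -> f (a *: x + y) = a * f x + f y),
      (forall x, A x -> `|f x| <= N x) &
      (forall d : R, 0 < d -> exists2 x, A x /\ N x <= 1 & 1 - d < f x)].

Definition slice (f : V -> R) (alpha : R) : set V :=
  [set z | [/\ A z, N z <= 1 & 1 - alpha < f z]].

Definition sdist (z : V) (S : set V) : R := inf [set N (z - s) | s in S].

Definition usphere : set V := [set z | A z /\ N z = 1].

Definition prop_starstar : Prop :=
  forall z1 z2, usphere z1 -> usphere z2 -> forall eps : R, 0 < eps ->
    exists2 f, dual_sphere f &
      let S := slice f eps in
      S z1 /\ sdist z2 S + sdist z2 [set - s | s in S] < 2 + eps.
End SeminormedSubspace.

Definition normed_prop_starstar (R : realType) (X : normedModType R) : Prop :=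
  @prop_starstar R X setT (fun x : X => `|x|).

Section Bochner.
Variables (d : measure_display) (T : measurableType d) (R : realType)
  (X : normedModType R) (mu : {measure set T -> \bar R}).

Definition msimple (s : T -> X) : Prop :=
  finite_set (range s) /\ forall x : X, measurable (s @^-1` [set x]).

Definition strongly_measurable (f : T -> X) : Prop :=
  exists s : nat -> T -> X, (forall n, msimple (s n)) /\
    forall t, (fun n => s n t) @ \oo --> f t.

Definition bochner_integrable (f : T -> X) : Prop :=
  strongly_measurable f /\ (\int[mu]_t (`|f t|%:E) < +oo)%E.

Definition L1norm (f : T -> X) : R := fine (\int[mu]_t (`|f t|%:E)).

Definition L1_prop_starstar : Prop :=
  @prop_starstar R (T -> X) bochner_integrable L1norm.
End Bochner.
Arguments L1_prop_starstar {d T R} X mu.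

(* Main.v *)
Require Import Defs.
From HB Require Import structures.
From mathcomp Require Import all_boot all_order all_algebra.
From mathcomp Require Import all_classical all_reals all_analysis.
From mathcomp Require Import measurable_realfun ring lra.
Set Implicit Arguments.
Unset Strict Implicit.
Unset Printing Implicit Defensive.
Import Order.TTheory GRing.Theory Num.Theory.
Import numFieldNormedType.Exports.
Local Open Scope classical_set_scope.
Local Open Scope ring_scope.

(** For a functional [F] in the dual ball call [N x - F x >= 0] the defect of
    [x].  Property (**) at unit vectors [z1], [z2] amounts to the existence,
    for every [e > 0], of [F] and of a decomposition [z2 = u - c] such that
    [u] and [c] have norm at most [1 + e] and [z1], [u], [c] have defect at
    most [e].

    From [X] to [L_1(mu, X)]: for simple functions [g1], [g2], decompose
    [g2 t] for each value of the pair [(g1 t, g2 t)] and integrate; norms and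
    defects are additive under integration, and simple functions are dense.

    From [L_1(mu, X)] to [X]: decompose [x2 1_E = u - c] with [u] simple.  On
    some cell [B] where [u] has a constant value [y], the functional
    [x |-> F (x 1_B) / mu B], the value [y] and [c = y - x2] have small
    defects and [|y| <= |x2| + s].  No bound on [|y - x2|] comes out of the
    averaging, since no single cell need be good for both norms.  One is
    recovered by first moving [x1] slightly: for small [tau > 0], either
    [|x1| <= |x1 + tau x2|], and a functional almost norming [x1 + tau x2] is
    almost nonnegative at [x2]; or [|x1 + tau x2| < |x1|], and a functional
    almost norming [x1] is almost nonnegative at [- x2].  Exchanging [u] and
    [c] turns a decomposition of [- x2] into one of [x2], so [phi x2 >= - s']
    may be assumed, and then
    [|y - x2| <= phi (y - x2) + s <= |x2| + 2 s + s']. *)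

(** * Seminormed subspaces, and the property expressed by decompositions *)

Section Splitting.
Variables (R : realType) (V : lmodType R) (A : set V) (N : V -> R).

(** The axioms are confined to [A]: through [fine], a non-integrable function may get the [L1norm]
    value 0. *)
Definition seminormed_subspace : Prop :=
  [/\ A 0, (forall a x y, A x -> A y -> A (a *: x + y)),
      (forall x y, A x -> A y -> N (x + y) <= N x + N y) &
      (forall a x, A x -> N (a *: x) = `|a| * N x)].

(** Norm at most one is kept under averaging and integration; norm exactly one is restored only in
    [splits_starstar]. *)
Definition dual_ball (F : V -> R) : Prop :=
  (forall (a : R) x y, A x -> A y -> F (a *: x + y) = a * F x + F y) /\
  (forall x, A x -> `|F x| <= N x).

(* [e1] is the tolerance at [z1], [e2] the one at [z2]: two parameters make the
   homogeneous form, with tolerances [e * N z1] and [e * N z2], expressible. *)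
Definition splits (F : V -> R) (z1 z2 u : V) (e1 e2 : R) : Prop :=
  [/\ A u, N z1 - F z1 <= e1, N u <= N z2 + e2 /\ N (u - z2) <= N z2 + e2,
      N u - F u <= e2 & N (u - z2) - F (u - z2) <= e2].

Hypothesis AN : seminormed_subspace.

Lemma subspace0 : A 0. Proof. by case: AN. Qed.

Lemma subspaceZ a x : A x -> A (a *: x).
Proof. by move=> Ax; rewrite -[_ *: _]addr0; case: AN => A0 + _ _; apply. Qed.

Lemma subspaceD x y : A x -> A y -> A (x + y).
Proof. by move=> Ax Ay; rewrite -[x]scale1r; case: AN => _ + _ _; apply. Qed.

Lemma subspaceN x : A x -> A (- x).
Proof. by rewrite -scaleN1r; apply: subspaceZ. Qed.

Lemma subspaceB x y : A x -> A y -> A (x - y).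
Proof. by move=> Ax Ay; apply: subspaceD => //; apply: subspaceN. Qed.

Lemma seminormD x y : A x -> A y -> N (x + y) <= N x + N y.
Proof. by case: AN => _ _ + _; apply. Qed.

Lemma seminormZ a x : A x -> N (a *: x) = `|a| * N x.
Proof. by case: AN => _ _ _; apply. Qed.

Lemma seminorm0 : N 0 = 0.
Proof. by rewrite -(scale0r 0) seminormZ ?normr0 ?mul0r//; exact: subspace0. Qed.

Lemma seminormN x : A x -> N (- x) = N x.
Proof. by move=> Ax; rewrite -scaleN1r seminormZ// normrN1 mul1r. Qed.

Lemma seminorm_distC x y : A x -> A y -> N (x - y) = N (y - x).
Proof.
by move=> Ax Ay; rewrite -opprB seminormN//; exact: subspaceB.
Qed.

Lemma seminorm_ge0 x : A x -> 0 <= N x.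
Proof.
move=> Ax; have := seminormD Ax (subspaceN Ax).
by rewrite subrr seminorm0 seminormN//; lra.
Qed.

Lemma seminormB x y : A x -> A y -> N x - N y <= N (x - y).
Proof.
move=> Ax Ay; have := seminormD (subspaceB Ax Ay) Ay.
by rewrite subrK; lra.
Qed.

Section DualBall.
Variables (F : V -> R) (Fball : dual_ball F).

Lemma dual_ball0 : F 0 = 0.
Proof.
have [_ /(_ _ subspace0)] := Fball; rewrite seminorm0 normr_le0.
by move=> /eqP.
Qed.

Lemma dual_ballZ a x : A x -> F (a *: x) = a * F x.
Proof.
have [FL _] := Fball; move=> Ax.
by rewrite -[a *: x]addr0 FL ?dual_ball0 ?addr0//; exact: subspace0.
Qed.

Lemma dual_ballD x y : A x -> A y -> F (x + y) = F x + F y.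
Proof.
by have [FL _] := Fball; move=> Ax Ay; rewrite -{1}[x]scale1r FL// mul1r.
Qed.

Lemma dual_ballN x : A x -> F (- x) = - F x.
Proof. by move=> Ax; rewrite -scaleN1r dual_ballZ// mulN1r. Qed.

Lemma dual_ballB x y : A x -> A y -> F (x - y) = F x - F y.
Proof. by move=> Ax Ay; rewrite dual_ballD ?dual_ballN//; exact: subspaceN. Qed.

Lemma dual_ball_le x : A x -> F x <= N x.
Proof. by have [_ FN] := Fball; move=> /FN; rewrite ler_norml => /andP[]. Qed.

Lemma dual_ball_ge x : A x -> - N x <= F x.
Proof. by have [_ FN] := Fball; move=> /FN; rewrite ler_norml => /andP[]. Qed.

(** Exchanges the two parts: [- z2 = (u - z2) - u]. *)
Lemma splits_opp z1 z2 u e1 e2 : A z2 -> splits F z1 z2 u e1 e2 ->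
  splits F z1 (- z2) (u - z2) e1 e2.
Proof.
move=> Az2 [Au D1 [Nu Nc] Du Dc].
by split; rewrite ?opprK ?subrK ?seminormN//; exact: subspaceB.
Qed.

(** [N] and [F] are 1-Lipschitz, so a defect moves by at most twice the displacement, and [u' - z2]
    lies within [2 * d2] of [u - w2]. *)
Lemma splits_near z1 z2 w1 w2 u u' e1 e2 d1 d2 :
  A z1 -> A z2 -> A w1 -> A w2 -> A u' -> splits F w1 w2 u e1 e2 ->
  N (z1 - w1) <= d1 -> N (z2 - w2) <= d2 -> N (u' - u) <= d2 ->
  splits F z1 z2 u' (e1 + 2 * d1) (e2 + 4 * d2).
Proof.
move=> Az1 Az2 Aw1 Aw2 Au' [Au D1 [Nu Nc] Du Dc] d1P d2P duP.
have defect x y d : A x -> A y -> N (x - y) <= d ->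
    [/\ N x <= N y + d, N y <= N x + d & F y <= F x + d].
  move=> Ax Ay xyd; have := seminormB Ax Ay; have := seminormB Ay Ax.
  rewrite (seminorm_distC Ay Ax) => ? ?.
  have := dual_ball_ge (subspaceB Ax Ay).
  by rewrite dual_ballB//; split; lra.
have [? ? ?] := defect _ _ _ Az1 Aw1 d1P.
have [? ? ?] := defect _ _ _ Az2 Aw2 d2P.
have [? ? ?] := defect _ _ _ Au' Au duP.
have cd : N (u' - z2 - (u - w2)) <= d2 + d2.
  rewrite (_ : u' - z2 - (u - w2) = u' - u - (z2 - w2)); last first.
    by rewrite !opprB addrACA [RHS]addrACA [- u - _]addrC.
  have Az2w2 := subspaceB Az2 Aw2.
  have := seminormD (subspaceB Au' Au) (subspaceN Az2w2).
  by rewrite (seminormN Az2w2); lra.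
have [? ? ?] := defect _ _ _ (subspaceB Au' Az2) (subspaceB Au Aw2) cd.
have d20 : 0 <= d2 by apply: le_trans d2P; exact/seminorm_ge0/subspaceB.
by split=> //; first lra; try split; lra.
Qed.

End DualBall.

Lemma dual_sphere_ball F : dual_sphere A N F -> dual_ball F.
Proof. by case. Qed.

Lemma dual_ball_cst0 : dual_ball (fun=> 0).
Proof.
split=> [a x y _ _|x Ax]; first by rewrite mulr0 addr0.
by rewrite normr0 seminorm_ge0.
Qed.

(** Take [u] and [- v] almost nearest to [z2] in the slice and in its opposite. Then [F (u - z2) + F
    (z2 + v) = F u + F v > 2 - 2 * e / 3], while the two norms sum to less than [2 + e / 3], so both
    defects are below [e]. *)
Lemma starstar_splits z1 z2 (e : R) : prop_starstar A N -> usphere A N z1 ->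
  usphere A N z2 -> 0 < e -> exists F u, dual_ball F /\ splits F z1 z2 u e e.
Proof.
move=> PS Sz1 Sz2 e0.
have [Az1 Nz1] := Sz1; have [Az2 Nz2] := Sz2.
have e3 : 0 < e / 3 by rewrite divr_gt0.
have [F /dual_sphere_ball Fb /= [[_ _ Fz1]]] := PS z1 z2 Sz1 Sz2 _ e3.
set S := slice A N F (e / 3) => dist.
have Sz : S z1 by split=> //; rewrite Nz1.
(* Half the gap left by the strict inequality, to be spent once in each infimum. *)
have e60 : 0 < (2 + e / 3 - (sdist N z2 S + sdist N z2 [set - s | s in S])) / 2.
  by rewrite divr_gt0// subr_gt0.
have near B : B `<=` A -> B !=set0 ->
    has_inf [set N (z2 - s) | s in B].
  move=> BA [b Bb]; split; first by exists (N (z2 - b)), b.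
  exists 0 => _ [s Bs <-]; apply: seminorm_ge0.
  by apply: subspaceB => //; exact: BA.
have SA : S `<=` A by move=> x [].
have [_ [u [Au Nu Fu] <-] zu] := inf_adherent e60 (near S SA (ex_intro _ z1 Sz)).
have /(inf_adherent e60) : has_inf [set N (z2 - s) | s in [set - s | s in S]].
  apply: near; last by exists (- z1), z1.
  by move=> _ [s [As _ _] <-]; exact: subspaceN.
move=> [_ [_ [v [Av Nv Fv] <-] <-]]; rewrite opprK => zv.
exists F; have : N (u - z2) + N (z2 + v) < 2 + e / 3.
  rewrite (seminorm_distC Au Az2); move: dist zu zv; rewrite /sdist.
  by move: (inf _) (inf _) => i1 i2; lra.
have := dual_ball_le Fb (subspaceB Au Az2).
have := dual_ball_le Fb (subspaceD Az2 Av).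
rewrite (dual_ballB Fb Au Az2) (dual_ballD Fb Az2 Av) => ? ? ?.
(* Both [u - z2] and [z2 + v] have small defect; the sign of [F z2] decides
   which of [z2 = u - (u - z2)] and [z2 = (z2 + v) - v] has small norms. *)
have [f0|f0] := leP 0 (F z2).
  exists u; split => //; split=> //; rewrite ?Nz1 ?Nz2 ?(dual_ballB Fb Au Az2); try split; lra.
exists (z2 + v); rewrite /splits.
have -> : z2 + v - z2 = v by rewrite addrC addKr.
split=> //; split => //; rewrite ?Nz1 ?Nz2 ?(dual_ballD Fb Az2 Av).
- exact: subspaceD.
- lra.
- split; lra.
- lra.
- lra.
Qed.

(** Tolerances proportional to the norms become, after integration, tolerances proportional to the
    [L1] norms. Vectors of seminorm 0, which cannot be normalised, are treated apart. *)
Lemma starstar_splits_rel z1 z2 (e : R) : prop_starstar A N -> A z1 -> A z2 ->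
  0 < e -> exists F u, dual_ball F /\ splits F z1 z2 u (e * N z1) (e * N z2).
Proof.
move=> PS Az1 Az2 e0.
have Nuz z : A z -> N z != 0 -> usphere A N ((N z)^-1 *: z).
  move=> Az Nz; split; first exact: subspaceZ.
  by rewrite seminormZ// normfV ger0_norm ?mulVf// seminorm_ge0.
have cone F z x k : dual_ball F -> A z -> N z != 0 -> A x ->
    N ((N z)^-1 *: x) - F ((N z)^-1 *: x) <= k -> N x - F x <= k * N z.
  move=> Fb Az Nz Ax; rewrite seminormZ// (dual_ballZ Fb)//.
  rewrite normfV ger0_norm ?seminorm_ge0// -mulrBr.
  by rewrite mulrC ler_pdivrMr// lt_neqAle eq_sym Nz seminorm_ge0.
have null F x : dual_ball F -> A x -> N x = 0 -> F x = 0.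
  move=> Fb Ax Nx; have := dual_ball_le Fb Ax; have := dual_ball_ge Fb Ax.
  by rewrite Nx; lra.
have [Nz2|Nz2] := eqVneq (N z2) 0.
  have split0 F : dual_ball F -> N z1 - F z1 <= e * N z1 ->
      splits F z1 z2 0 (e * N z1) (e * N z2).
    move=> Fb D1; rewrite /splits sub0r seminormN// seminorm0 (dual_ball0 Fb).
    rewrite Nz2 (dual_ballN Fb)// (null F z2)//.
    split; [exact: subspace0| |split| |]; lra.
  have [Nz1|Nz1] := eqVneq (N z1) 0.
    exists (fun=> 0), 0; split; first exact: dual_ball_cst0.
    by apply: split0; [exact: dual_ball_cst0|rewrite Nz1; lra].
  have S1 := Nuz _ Az1 Nz1.
  have [F [u [Fb [_ D1 _ _ _]]]] := starstar_splits PS S1 S1 e0.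
  by exists F, 0; split=> //; apply: split0 => //; exact: (cone F z1).
have split1 F w1 u : dual_ball F -> N z1 - F z1 <= e * N z1 ->
    splits F w1 ((N z2)^-1 *: z2) u e e ->
    splits F z1 z2 (N z2 *: u) (e * N z1) (e * N z2).
  move=> Fb D1 [Au _ [Nu Nc] Du Dc].
  have N20 : 0 < N z2 by rewrite lt_neqAle eq_sym Nz2 seminorm_ge0.
  have Au2 : A (N z2 *: u) by exact: subspaceZ.
  have Ac : A (N z2 *: u - z2) by exact: subspaceB.
  have E1 : (N z2)^-1 *: (N z2 *: u) = u by rewrite scalerA mulVf// scale1r.
  have E2 : (N z2)^-1 *: (N z2 *: u - z2) = u - (N z2)^-1 *: z2.
    by rewrite scalerBr E1.
  have bound x : A x -> N ((N z2)^-1 *: x) <= 1 + e -> N x <= N z2 + e * N z2.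
    move=> Ax; rewrite seminormZ// normfV gtr0_norm// mulrC ler_pdivrMr//.
    by rewrite mulrDl mul1r.
  have [_ N1] := Nuz _ Az2 Nz2.
  split=> //; [split| |].
  - by apply: bound => //; rewrite E1; rewrite N1 in Nu.
  - by apply: bound => //; rewrite E2; rewrite N1 in Nc.
  - by apply: (cone F z2) => //; rewrite E1.
  - by apply: (cone F z2) => //; rewrite E2.
have S2 := Nuz _ Az2 Nz2.
have [Nz1|Nz1] := eqVneq (N z1) 0.
  have [F [u [Fb sp]]] := starstar_splits PS S2 S2 e0.
  exists F, (N z2 *: u); split=> //; apply: (split1 F _ u Fb _ sp).
  by rewrite (null F z1)// Nz1; lra.
have [F [u [Fb sp]]] := starstar_splits PS (Nuz _ Az1 Nz1) S2 e0.
exists F, (N z2 *: u); split=> //; apply: (split1 F _ u Fb _ sp).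
by apply: (cone F z1) => //; case: sp.
Qed.

(** If [U] and [W] are points of the slice close to [u] and [u - z2], the two distances are at most
    [N (U - u) + N (u - z2)] and [N (W - (u - z2)) + N u]. *)
Lemma splits_starstar :
  (forall z1 z2 (e : R), usphere A N z1 -> usphere A N z2 -> 0 < e ->
     exists F u, dual_ball F /\ splits F z1 z2 u e e) -> prop_starstar A N.
Proof.
move=> H z1 z2 Sz1 Sz2 eps eps0.
have [Az1 Nz1] := Sz1; have [Az2 Nz2] := Sz2.
(* The losses [3 * s] and [4 * s] stay below [eps], and [1 - 3 * s] is positive, so that [F] can be
   renormalised. *)
pose s := Num.min (eps / 8) 8^-1.
have s0 : 0 < s by rewrite lt_min; apply/andP; split; lra.
have [sle1 sle2] : s <= eps / 8 /\ s <= 8^-1.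
  by split; rewrite ge_min lexx// orbT.
have [F [u [Fb [Au D1 [Nu Nc] Du Dc]]]] := H z1 z2 s Sz1 Sz2 s0.
have Ac := subspaceB Au Az2.
rewrite Nz1 in D1; rewrite Nz2 in Nu Nc.
(* Adding [(1 - N x)^+ *: z1] and rescaling moves a vector of small defect into
   the slice; the two distances then add up to
   [max 1 (N u) + max 1 (N (u - z2))] up to [4 * s]. *)
have fill x : A x -> N x <= 1 + s -> N x - F x <= s ->
    exists2 y, [/\ A y, N y <= 1 & 1 - 3 * s <= F y] &
      N (y - x) + N x <= 1 + 2 * s.
  move=> Ax Nx Dx; pose r := Num.max 0 (1 - N x).
  have := seminorm_ge0 Ax.
  have : r = 0 /\ 1 <= N x \/ r = 1 - N x /\ N x <= 1.
    by rewrite /r; case: (leP 0 (1 - N x)) => ?; [right|left]; split; lra.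
  move: (r) => {}r rP Nx0.
  have r0 : 0 <= r by case: rP; lra.
  have r1 : N x + r <= 1 + s by case: rP; lra.
  have r2 : 1 <= N x + r by case: rP; lra.
  have r3 : r <= 1 by case: rP; lra.
  have Arz : A (r *: z1) by exact: subspaceZ.
  have Nrz : N (r *: z1) = r by rewrite seminormZ// Nz1 mulr1 ger0_norm.
  have Ay0 : A (x + r *: z1) by exact: subspaceD.
  have Ny0 : N (x + r *: z1) <= 1 + s.
    by apply: le_trans (seminormD Ax Arz) _; rewrite Nrz; lra.
  have Fy0 : 1 - 2 * s <= F (x + r *: z1).
    rewrite (dual_ballD Fb)// (dual_ballZ Fb)//.
    have : r * (1 - s) <= r * F z1 by rewrite ler_wpM2l//; lra.
    have : r * s <= 1 * s by rewrite ler_wpM2r//; lra.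
    by lra.
  have k0 : 0 < 1 + s by lra.
  exists ((1 + s)^-1 *: (x + r *: z1)).
    split; first exact: subspaceZ.
      by rewrite seminormZ// normfV gtr0_norm// mulrC ler_pdivrMr// mul1r.
    rewrite (dual_ballZ Fb)// [_^-1 * _]mulrC ler_pdivlMr//.
    have : 0 <= s * s by rewrite mulr_ge0// ltW.
    by lra.
  have -> : (1 + s)^-1 *: (x + r *: z1) - x =
      r *: z1 + (- (s / (1 + s))) *: (x + r *: z1).
    have -> : - (s / (1 + s)) = (1 + s)^-1 - 1.
      by field; rewrite gt_eqF.
    by rewrite scalerBl scale1r addrCA opprD [r *: z1 + _]addrCA subrr addr0.
  apply: le_trans (lerD (seminormD _ _) (lexx _)) _ => //.
    exact: subspaceZ.
  rewrite Nrz seminormZ// normrN ger0_norm; last by rewrite divr_ge0 ?ltW.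
  have : s / (1 + s) * N (x + r *: z1) <= s.
    by rewrite mulrAC ler_pdivrMr// ler_wpM2l// ltW.
  by lra.
have [U [AU NU FU] dU] := fill u Au Nu Du.
have [W [AW NW FW] dW] := fill (u - z2) Ac Nc Dc.
(* [F] is replaced by [G = F / c], which has norm exactly one. *)
pose B := [set F x | x in [set x | A x /\ N x <= 1]].
have supB : has_sup B.
  split; first by exists (F U), U.
  by exists 1 => _ [x [Ax Nx] <-]; apply: le_trans (dual_ball_le Fb Ax) _.
pose c := sup B.
have cge x : A x -> N x <= 1 -> F x <= c.
  by move=> Ax Nx; apply: (sup_upper_bound supB); exists x.
have c0 : 0 < c by apply: lt_le_trans (cge U AU NU); lra.
have c1 : c <= 1.
  apply: ge_sup; first by case: supB.
  by move=> _ [x [Ax Nx] <-]; apply: le_trans (dual_ball_le Fb Ax) _.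
pose G x := c^-1 * F x.
(* Since [c <= 1], dividing by [c] only raises nonnegative values, so [U], [W] and [z1] enter the
   slice of [G]. *)
have GF x : 0 <= F x -> F x <= G x.
  by move=> Fx; rewrite /G mulrC ler_pdivlMr// ler_piMr.
have Gle x : A x -> G x <= N x.
  move=> Ax; have := seminorm_ge0 Ax; rewrite [0 <= _]le_eqVlt => /orP[/eqP Nx|Nx].
    have := dual_ball_le Fb Ax; have := dual_ball_ge Fb Ax; rewrite /G -Nx => ? ?.
    by rewrite (_ : F x = 0) ?mulr0//; lra.
  have : F ((N x)^-1 *: x) <= c.
    apply: cge; first exact: subspaceZ.
    by rewrite seminormZ// normfV gtr0_norm// mulVf// gt_eqF.
  rewrite (dual_ballZ Fb)// mulrC ler_pdivrMr// => FN.
  by rewrite /G mulrC ler_pdivrMr// mulrC.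
have SU : slice A N G eps U.
  split=> //; have := GF U; move: (G U) => GU; lra.
have SW : slice A N G eps W.
  split=> //; have := GF W; move: (G W) => GW; lra.
exists G.
  split.
  - move=> a x y Ax Ay; rewrite /G; have [-> // _] := Fb.
    by ring.
  - move=> x Ax; rewrite ler_norml Gle// andbT lerNl -(seminormN Ax).
    have -> : - G x = G (- x) by rewrite /G (dual_ballN Fb)// mulrN.
    by apply: Gle; exact: subspaceN.
  - move=> d d0; have cd : 0 < c * d by rewrite mulr_gt0.
    have [_ [x [Ax Nx] <-] xP] := sup_adherent cd supB.
    exists x => //; rewrite /G mulrC ltr_pdivlMr//.
    by rewrite mulrBl mul1r mulrC.
split.
  split=> //; first by rewrite Nz1.
  have := GF z1; move: (G z1) => Gz; lra.
have sdle B' s' : B' `<=` A -> B' s' ->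
    sdist N z2 B' <= N (z2 - s').
  move=> B'A B's; apply: ge_inf; last by exists s'.
  exists 0 => _ [x Bx <-]; apply: seminorm_ge0.
  by apply: subspaceB => //; exact: B'A.
have d1 : sdist N z2 (slice A N G eps) <= N (z2 - U).
  by apply: sdle => // x [].
have d2 : sdist N z2 [set - s | s in slice A N G eps] <= N (z2 - (- W)).
  apply: sdle => //; last by exists W.
  by move=> _ [x [Ax _ _] <-]; exact: subspaceN.
have zU : N (z2 - U) <= N (U - u) + N (u - z2).
  rewrite (seminorm_distC Az2 AU).
  have -> : U - z2 = (U - u) + (u - z2) by rewrite addrA subrK.
  by apply: seminormD => //; exact: subspaceB.
have zW : N (z2 - (- W)) <= N (W - (u - z2)) + N u.
  have -> : z2 - - W = (W - (u - z2)) + u by rewrite opprK opprB addrA subrK addrC.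
  by apply: seminormD => //; exact: subspaceB.
lra.
Qed.

End Splitting.

(** * Finitely valued measurable maps *)

Section FinValued.
Context d (T : measurableType d).

(* [msimple] is definitionally the case of a normed target space. *)
Definition fin_valued (Y : Type) (s : T -> Y) : Prop :=
  finite_set (range s) /\ forall y, measurable (s @^-1` [set y]).

(** [Y] carries no sigma-algebra: a preimage is a finite union of measurable fibres, whatever the
    set [B]. *)
Lemma fin_valued_preimage (Y : Type) (s : T -> Y) (B : set Y) :
  fin_valued s -> measurable (s @^-1` B).
Proof.
move=> [sfin sm].
rewrite (_ : s @^-1` B = \bigcup_(y in range s `&` B) (s @^-1` [set y])).
  by apply: fin_bigcup_measurable => //; apply: sub_finite_set sfin => y [].
apply/seteqP; split=> [t Bst|t [y [_ By] /= ->]//].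
by exists (s t) => //; split=> //; exists t.
Qed.

(** As [g] is arbitrary, selections made by choice may be composed with [s]. *)
Lemma fin_valued_comp (Y Z : Type) (g : Y -> Z) (s : T -> Y) :
  fin_valued s -> fin_valued (g \o s).
Proof.
move=> sP; split.
  have [sfin _] := sP; apply: sub_finite_set (finite_image g sfin).
  by move=> _ [t _ <-]; exists (s t) => //; exists t.
by move=> z; rewrite comp_preimage; exact: fin_valued_preimage.
Qed.

Lemma fin_valued_pair (Y Z : Type) (s : T -> Y) (s' : T -> Z) :
  fin_valued s -> fin_valued s' -> fin_valued (fun t => (s t, s' t)).
Proof.
move=> [sfin sm] [s'fin s'm]; split.
  apply: sub_finite_set (finite_setX sfin s'fin).
  by move=> _ [t _ <-]; split; exists t.
move=> [y z]; rewrite (_ : _ @^-1` _ = s @^-1` [set y] `&` s' @^-1` [set z]).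
  exact: measurableI.
by apply/seteqP; split=> [t [<- <-]//|t /= [-> ->]].
Qed.

Lemma fin_valued_cst (Y : Type) (y : Y) : fin_valued (fun _ : T => y).
Proof.
split; first by apply: sub_finite_set (finite_set1 y) => _ [_ _ <-].
by move=> z; rewrite (_ : (fun=> y) = cst y)// preimage_cst; case: ifP.
Qed.

Lemma fin_valued_mem (B : set T) : measurable B ->
  fin_valued (fun t => t \in B).
Proof.
move=> mB; split; first exact: finite_finset.
move=> [].
  rewrite (_ : _ @^-1` _ = B)//.
  by apply/seteqP; split=> t; [exact: set_mem|exact: mem_set].
rewrite (_ : _ @^-1` _ = ~` B); first exact: measurableC.
by apply/seteqP; split=> t /=; [move=> /negbT|move=> ?; apply/negbTE];
  rewrite notin_setE.
Qed.

Lemma fin_valued_measurable (R : realType) (s : T -> R) : fin_valued s ->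
  measurable_fun setT s.
Proof. by move=> sP _ B _; rewrite setTI; exact: fin_valued_preimage. Qed.

End FinValued.

(** * Strongly measurable maps and their restriction to measurable sets *)

Section StrongMeasurability.
Context d (T : measurableType d) (R : realType) (X : normedModType R).

Lemma fin_valued_strongly_measurable (s : T -> X) : fin_valued s ->
  strongly_measurable s.
Proof. by move=> sP; exists (fun=> s); split=> // t; exact: cvg_cst. Qed.

Lemma strongly_measurable_lin (a : R) (f g : T -> X) :
  strongly_measurable f -> strongly_measurable g ->
  strongly_measurable (a *: f + g).
Proof.
move=> [s [sP sf]] [s' [s'P s'g]].
exists (fun n => (fun p : X * X => a *: p.1 + p.2) \o (fun t => (s n t, s' n t))).
split=> [n|t]; first exact: fin_valued_comp (fin_valued_pair (sP n) (s'P n)).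
apply: (@cvgD _ _ _ _ _ (fun n => a *: s n t) (fun n => s' n t)) => //.
by apply: cvgZ => //; exact: cvg_cst.
Qed.

(** Only [f] is replaced by simple functions, and [G (w t)] passes to the limit pointwise; the
    finitely many values of [w] make each approximation finitely valued. *)
Lemma measurable_strong_comp (W : Type) (w : T -> W) (G : W -> X -> R)
    (f : T -> X) : fin_valued w -> (forall y, continuous (G y)) ->
  strongly_measurable f -> measurable_fun setT (fun t => G (w t) (f t)).
Proof.
move=> wP Gc [s [sP sf]].
apply: (@measurable_fun_cvg _ _ _ _
  (fun n => (fun p : W * X => G p.1 p.2) \o (fun t => (w t, s n t)))).
  move=> n; apply/fin_valued_measurable/fin_valued_comp.
  exact: fin_valued_pair wP (sP n).
by move=> t _; exact: (cvg_comp _ _ (sf t) (Gc (w t) (f t))).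
Qed.

Lemma measurable_strong_norm (f : T -> X) : strongly_measurable f ->
  measurable_fun setT (fun t => `|f t|).
Proof.
move=> fm; apply: (@measurable_strong_comp unit (fun=> tt) (fun _ x => `|x|)) => //.
  exact: fin_valued_cst.
by move=> _; exact: norm_continuous.
Qed.

(** Extension by zero keeps localised functions in the domain of functionals on the whole space. *)
Definition cutoff (B : set T) (f : T -> X) (t : T) : X :=
  if t \in B then f t else 0.

Lemma norm_cutoff_le B f t : `|cutoff B f t| <= `|f t|.
Proof. by rewrite /cutoff; case: ifP => // _; rewrite normr0. Qed.

Lemma fin_valued_cutoff B f : measurable B -> fin_valued f ->
  fin_valued (cutoff B f).
Proof.
move=> mB fP.
apply: (@fin_valued_comp _ _ _ _ (fun p : bool * X => if p.1 then p.2 else 0)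
  (fun t => (t \in B, f t))).
by apply: fin_valued_pair => //; exact: fin_valued_mem.
Qed.

Lemma strongly_measurable_cutoff B f : measurable B ->
  strongly_measurable f -> strongly_measurable (cutoff B f).
Proof.
move=> mB [s [sP sf]]; exists (fun n => cutoff B (s n)); split.
  by move=> n; exact: (fin_valued_cutoff mB (sP n)).
by move=> t; rewrite /cutoff; case: ifP => // _; exact: cvg_cst.
Qed.

End StrongMeasurability.

(** * The [L1] seminorm and the density of simple functions *)

Section L1.
Context d (T : measurableType d) (R : realType) (X : normedModType R).
Variable mu : {measure set T -> \bar R}.
Implicit Types f g : T -> X.

Local Notation L1 := (@bochner_integrable d T R X mu).
Local Notation N := (@L1norm d T R X mu).

Lemma L1normE f : N f = \int[mu]_t `|f t|. Proof. by []. Qed.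

Lemma bochner_integrable_norm f : L1 f ->
  mu.-integrable setT (EFin \o (fun t => `|f t|)).
Proof.
move=> [fm fi]; apply/integrableP; split.
  exact/measurable_EFinP/measurable_strong_norm.
by under eq_integral do rewrite /= normr_id.
Qed.

Lemma bochner_integrableP f (h : T -> R) : strongly_measurable f ->
  mu.-integrable setT (EFin \o h) -> (forall t, `|f t| <= h t) -> L1 f.
Proof.
move=> fm hi fh; split=> //.
have /integrableP[_] : mu.-integrable setT (EFin \o (fun t => `|f t|)).
  apply: le_integrable hi => //.
    exact/measurable_EFinP/measurable_strong_norm.
  by move=> t _ /=; rewrite lee_fin normr_id (le_trans (fh t))// ler_norm.
by under eq_integral do rewrite /= normr_id.
Qed.

Lemma bochner_integrable_le f g : strongly_measurable f -> L1 g ->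
  (forall t, `|f t| <= `|g t|) -> L1 f.
Proof.
by move=> fm /bochner_integrable_norm gi; exact: bochner_integrableP.
Qed.

Lemma bochner_seminormed : seminormed_subspace L1 N.
Proof.
split.
- apply: (@bochner_integrableP _ (fun=> 0)).
  + exact/fin_valued_strongly_measurable/fin_valued_cst.
  + exact: integrable0.
  + by move=> t; rewrite normr0.
- move=> a f g fL gL.
  apply: (@bochner_integrableP _ (fun t => `|a| * `|f t| + `|g t|)).
  + by apply: strongly_measurable_lin; [case: fL|case: gL].
  + rewrite (_ : EFin \o _ = (fun t => `|a|%:E * (`|f t|%:E))%E \+
                             (EFin \o (fun t => `|g t|%R)))%E//.
    apply: integrableD => //; last exact: bochner_integrable_norm.
    exact/integrableZl/bochner_integrable_norm.
  + by move=> t; rewrite -normrZ; exact: ler_normD.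
- move=> f g fL gL; rewrite !L1normE.
  have fi := bochner_integrable_norm fL; have gi := bochner_integrable_norm gL.
  rewrite -RintegralD//; apply: le_Rintegral => //.
  + apply/bochner_integrable_norm/(@bochner_integrableP _ (fun t => `|f t| + `|g t|)).
    * rewrite -[f]scale1r; apply: strongly_measurable_lin; [by case: fL|by case: gL].
    * exact: (integrableD measurableT fi gi).
    * by move=> t; exact: ler_normD.
  + exact: (integrableD measurableT fi gi).
  + by move=> t _; exact: ler_normD.
- move=> a f fL; rewrite !L1normE -RintegralZl//; last exact: bochner_integrable_norm.
  by apply: eq_Rintegral => t _; rewrite -normrZ.
Qed.

Lemma L1norm_le f g : L1 f -> L1 g -> (forall t, `|f t| <= `|g t|) -> N f <= N g.
Proof.
move=> fL gL fg; rewrite !L1normE.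
by apply: le_Rintegral => //; exact: bochner_integrable_norm.
Qed.

Lemma bochner_cutoff B f : measurable B -> L1 f -> L1 (cutoff B f).
Proof.
move=> mB fL; apply: (@bochner_integrable_le _ f) => //.
  by apply: strongly_measurable_cutoff => //; case: fL.
by move=> t; exact: norm_cutoff_le.
Qed.

Lemma bochner_simple_dense f (e : R) : L1 f -> 0 < e ->
  exists g, [/\ fin_valued g, L1 g & N (f - g) <= e].
Proof.
move=> fL e0; have [[s [sP sf]] _] := fL.
have fi := bochner_integrable_norm fL.
have [fm _] := fL.
(* Truncating [s n] where it exceeds [2 * `|f|] makes [3 * `|f|] a dominating
   function. *)
pose B n := [set t | `|s n t| <= 2 * `|f t|].
have mB n : measurable (B n).
  rewrite -[B n]setTI; apply: measurable_fun_le => //.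
    exact: measurable_strong_norm (fin_valued_strongly_measurable (sP n)).
  by apply: measurable_funM => //; exact: measurable_strong_norm.
pose g n := cutoff (B n) (s n).
have gfin n : fin_valued (g n) := fin_valued_cutoff (mB n) (sP n).
have gle n t : `|g n t| <= 2 * `|f t|.
  rewrite /g /cutoff; case: ifPn => [|_]; first by rewrite in_setE.
  by rewrite normr0 mulr_ge0.
have f2i : mu.-integrable setT (EFin \o (fun t => 2 * `|f t|)).
  rewrite (_ : EFin \o _ = (fun t => 2%:E * (`|f t|%:E))%E)//.
  exact: integrableZl.
have gL n : L1 (g n).
  exact: bochner_integrableP (fin_valued_strongly_measurable (gfin n)) f2i (gle n).
have f3i : mu.-integrable setT (EFin \o (fun t => `|f t| + 2 * `|f t|)).
  rewrite (_ : EFin \o _ = ((EFin \o (fun t => `|f t|%R)) \+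
    (EFin \o (fun t => 2 * `|f t|)%R))%E)//.
  exact: (integrableD measurableT fi f2i).
have fgm n : strongly_measurable (f - g n).
  rewrite addrC -[- g n]scaleN1r; apply: strongly_measurable_lin => //.
  exact: fin_valued_strongly_measurable.
have fgL n : L1 (f - g n).
  apply: bochner_integrableP f3i _ => // t.
  by apply: le_trans (ler_normB _ _) _; rewrite lerD2l.
(* Where [f t = 0] the truncation gives 0; elsewhere it is inactive once the distance from [s n t]
   to [f t] is less than the norm of [f t]. *)
have gf t : g n t @[n --> \oo] --> f t.
  have [ft0|ft0] := eqVneq (f t) 0.
    rewrite ft0 (_ : (fun n => g n t) = fun=> 0); first exact: cvg_cst.
    apply/funext => n; apply/eqP; rewrite -normr_le0.
    by have := gle n t; rewrite ft0 normr0 mulr0.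
  have nft : 0 < `|f t| by rewrite normr_gt0.
  apply: (cvg_trans _ (sf t)); apply: near_eq_cvg; near=> n.
  rewrite /g /cutoff ifT// in_setE /B /=.
  have : `|f t - s n t| < `|f t|.
    by near: n; have /cvgrPdist_lt := sf t; apply.
  have := lerB_dist (s n t) (f t); rewrite distrC; lra.
have cv : (\int[mu]_t (`|(f - g n) t|)%:E @[n --> \oo] --> (\int[mu]_(t in setT) (0 : \bar R)))%E.
  apply: (@dominated_cvg _ _ _ mu _ measurableT
    (fun n t => (`|(f - g n) t|)%:E) (cst 0%E)
    (EFin \o (fun t => `|f t| + 2 * `|f t|))) => //.
  - by move=> n; exact/measurable_EFinP/measurable_strong_norm.
  - move=> t _; apply: cvg_EFin; first by near=> n.
    rewrite -(normr0 X) -(subrr (f t)); apply: cvg_norm.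
    by apply: cvgB; [exact: cvg_cst|].
  - move=> n t _ /=; rewrite lee_fin normr_id.
    by apply: le_trans (ler_normB _ _) _; rewrite lerD2l.
rewrite integral0 in cv.
have /fine_cvg/cvgr_dist_lt/(_ e e0)[n _ /(_ n (leqnn n))] := cv.
rewrite /= sub0r normrN => dn.
exists (g n); split=> //; apply/ltW/(le_lt_trans _ dn).
exact: ler_norm.
Unshelve. all: by end_near. Qed.

End L1.

(** * Normed spaces as seminormed subspaces *)

Section NormedSpace.
Context (R : realType) (X : normedModType R).

Lemma normed_seminormed : @seminormed_subspace R X setT (fun x => `|x|).
Proof. by split=> // [x y _ _|a x _]; [exact: ler_normD|exact: normrZ]. Qed.

Lemma dual_ball_continuous (F : X -> R) :
  dual_ball setT (fun x => `|x|) F -> continuous F.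
Proof.
move=> Fb x; apply/cvgrPdist_le => e e0.
near=> y; rewrite -(dual_ballB normed_seminormed Fb)//.
have [_ F1] := Fb; apply: le_trans (F1 _ I) _.
near: y; exact: cvgr_dist_le.
Unshelve. all: by end_near. Qed.

End NormedSpace.

Lemma splits_weaken (R : realType) (V : lmodType R) (A : set V) (N F : V -> R)
    z1 z2 u (e1 e2 e : R) : splits A N F z1 z2 u e1 e2 -> e1 <= e -> e2 <= e ->
  splits A N F z1 z2 u e e.
Proof.
move=> [Au D1 [Nu Nc] Du Dc] e1e e2e.
split=> //; [exact: le_trans e1e|split|exact: le_trans e2e..].
- by apply: le_trans Nu _; rewrite lerD2l.
- by apply: le_trans Nc _; rewrite lerD2l.
Qed.

(** * From [X] to [L1]: integration of pointwise decompositions *)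

Section Lifting.
Context d (T : measurableType d) (R : realType) (X : normedModType R).
Variable mu : {measure set T -> \bar R}.

Local Notation L1 := (@bochner_integrable d T R X mu).
Local Notation N := (@L1norm d T R X mu).

Lemma simple_splits (g1 g2 : T -> X) (e : R) : normed_prop_starstar X -> 0 < e ->
  fin_valued g1 -> fin_valued g2 -> L1 g1 -> L1 g2 ->
  exists F u, dual_ball L1 N F /\ splits L1 N F g1 g2 u (e * N g1) (e * N g2).
Proof.
move=> PX e0 g1s g2s g1L g2L.
(* One choice for each pair of vectors; since [w] below is finitely valued, the chosen functionals
   and vectors depend measurably on [t]. *)
have /choice[Q QP] (p : X * X) : exists q : (X -> R) * X,
    dual_ball setT (fun x => `|x|) q.1 /\
    splits setT (fun x => `|x|) q.1 p.1 p.2 q.2 (e * `|p.1|) (e * `|p.2|).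
  have [F [u]] := starstar_splits_rel (normed_seminormed X) PX
    (I : setT p.1) (I : setT p.2) e0.
  by exists (F, u).
pose w t := (g1 t, g2 t).
have ws : fin_valued w by exact: fin_valued_pair.
pose G (p : X * X) := (Q p).1.
have Gb p : dual_ball setT (fun x : X => `|x|) (G p) by case: (QP p).
pose F h := \int[mu]_t G (w t) (h t).
pose u t := (Q (w t)).2.
have Gi h : L1 h -> mu.-integrable setT (EFin \o (fun t => G (w t) (h t))).
  move=> hL; have := bochner_integrable_norm hL; apply: le_integrable => //.
    apply/measurable_EFinP/measurable_strong_comp => //.
      by move=> p; exact: dual_ball_continuous.
    by case: hL.
  move=> t _ /=; rewrite lee_fin normr_id.
  by have [_] := Gb (w t); apply.
have Fb : dual_ball L1 N F.
  split=> [a x y xL yL|x xL].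
    rewrite /F -RintegralZl//; last exact: Gi.
    have axi : mu.-integrable setT (EFin \o (fun t => a * G (w t) (x t))).
      exact: (integrableZl measurableT a (Gi x xL)).
    rewrite -(RintegralD measurableT axi (Gi y yL)).
    apply: eq_Rintegral => t _.
    by have [->] := Gb (w t).
  rewrite /F; apply: le_trans (le_normr_Rintegral measurableT (Gi x xL)) _.
  apply: le_Rintegral => //.
  - have := Gi x xL => /integrable_norm.
    by apply: eq_integrable.
  - exact: bochner_integrable_norm.
  - by move=> t _; have [_] := Gb (w t); apply.
have ufin : fin_valued u by exact: (fin_valued_comp (fun p => (Q p).2) ws).
have um := fin_valued_strongly_measurable ufin.
have split_t t : splits setT (fun x : X => `|x|) (G (w t)) (g1 t) (g2 t) (u t)
    (e * `|g1 t|) (e * `|g2 t|) by case: (QP (w t)).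
have ni h := @bochner_integrable_norm _ _ _ X mu h.
have sc (k : R) h : L1 h -> mu.-integrable setT (EFin \o (fun t => k * `|h t|)).
  by move=> hL; exact: (integrableZl measurableT k (ni h hL)).
have e1g t : `|g2 t| + e * `|g2 t| = (1 + e) * `|g2 t| by rewrite mulrDl mul1r.
have uL : L1 u.
  apply: (bochner_integrableP um (sc (1 + e) g2 g2L)) => t.
  by have [_ _ [+ _] _ _] := split_t t; rewrite e1g.
have cL : L1 (u - g2) := subspaceB (bochner_seminormed X mu) uL g2L.
have norm_bound h : L1 h -> (forall t, `|h t| <= `|g2 t| + e * `|g2 t|) ->
    N h <= N g2 + e * N g2.
  move=> hL hg; rewrite -[X in X + _]mul1r -mulrDl.
  rewrite !L1normE -RintegralZl//; last exact: ni.
  apply: le_Rintegral => //; [exact: ni|exact: sc|].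
  by move=> t _; rewrite -e1g.
have defect_bound h g : L1 h -> L1 g ->
    (forall t, `|h t| - G (w t) (h t) <= e * `|g t|) -> N h - F h <= e * N g.
  move=> hL gL hg; rewrite !L1normE -RintegralZl//; last exact: ni.
  rewrite -RintegralB//; [|exact: ni|exact: Gi].
  apply: le_Rintegral => //; [|exact: sc].
  exact: (integrableB measurableT (ni h hL) (Gi h hL)).
exists F, u; split=> //; split=> //.
- by apply: defect_bound => // t; case: (split_t t).
- by split; apply: norm_bound => // t; have [_ _ []] := split_t t.
- by apply: defect_bound => // t; case: (split_t t).
- by apply: defect_bound => // t; case: (split_t t).
Qed.

Lemma starstar_L1 : normed_prop_starstar X -> L1_prop_starstar X mu.
Proof.
move=> PX; have sn := bochner_seminormed X mu.
apply: (splits_starstar sn) => z1 z2 e [Lz1 Nz1] [Lz2 Nz2] e0.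
(* [N g1] and [N g2] will be at most 2, so the relative tolerances are at most [2 * r]; the
   approximation adds at most [4 * r], and [6 * r <= e]. *)
pose r := Num.min (e / 8) 1.
have r0 : 0 < r by rewrite lt_min; apply/andP; split; lra.
have [re r1] : r <= e / 8 /\ r <= 1.
  by split; rewrite ge_min lexx// orbT.
have [g1 [g1s Lg1 zg1]] := bochner_simple_dense Lz1 r0.
have [g2 [g2s Lg2 zg2]] := bochner_simple_dense Lz2 r0.
have [F [u [Fb sp]]] := simple_splits PX r0 g1s g2s Lg1 Lg2.
exists F, u; split=> //.
have Lu : L1 u by case: sp.
have uu : N (u - u) <= r by rewrite subrr (seminorm0 sn) ltW.
have bound z g : L1 z -> L1 g -> N z = 1 -> N (z - g) <= r -> r * N g <= 2 * r.
  move=> Lz Lg Nz; rewrite (seminorm_distC sn)// => zg; rewrite mulrC ler_pM2r//.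
  by have := seminormB sn Lg Lz; lra.
have := bound _ _ Lz1 Lg1 Nz1 zg1; have := bound _ _ Lz2 Lg2 Nz2 zg2.
move=> b2 b1.
by apply: (splits_weaken (splits_near sn Fb Lz1 Lz2 Lg1 Lg2 Lu sp zg1 zg2 uu)); lra.
Qed.

End Lifting.

(** Averaging: [k] is additive and [k E <= 0], so some fibre that is not [m]-null has [k <= 0], the
    null ones contributing nothing. Additivity is asked only inside [E], where [fine] of the measure
    is additive. *)
Lemma finite_partition_pigeonhole d (T : measurableType d) (R : realType)
    (Y : eqType) (w : T -> Y) (E : set T) (m k : set T -> R) :
  fin_valued w -> measurable E ->
  (forall B, 0 <= m B) -> m set0 = 0 ->
  (forall B B', measurable B -> measurable B' -> B `|` B' `<=` E ->
     B `&` B' = set0 -> m (B `|` B') = m B + m B') ->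
  (forall B B', measurable B -> measurable B' -> B `|` B' `<=` E ->
     B `&` B' = set0 -> k (B `|` B') = k B + k B') ->
  (forall B, measurable B -> B `<=` E -> m B = 0 -> k B = 0) ->
  0 < m E -> k E <= 0 ->
  exists B y, [/\ measurable B, B `<=` E, forall t, B t -> w t = y, 0 < m B &
    k B <= 0].
Proof.
move=> ws mE m0 mset0 mD kD k0.
have [/finite_seqP[s sE] wm] := ws.
suff gen (r : seq Y) B : measurable B -> B `<=` E ->
    (forall t, B t -> w t \in r) -> 0 < m B -> k B <= 0 ->
    exists B' y, [/\ measurable B', B' `<=` E, forall t, B' t -> w t = y,
      0 < m B' & k B' <= 0].
  apply: (gen s) => // t _.
  by have : range w (w t) by [exists t]; rewrite sE.
elim: r B => [|y r IH] B mB BE ws' mB0 kB.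
  suff B0 : B = set0 by rewrite B0 mset0 ltxx in mB0.
  by rewrite -subset0 => t /ws'.
pose B1 := B `&` w @^-1` [set y]; pose B2 := B `\` w @^-1` [set y].
have mB1 : measurable B1 by exact: measurableI.
have mB2 : measurable B2 by exact: measurableD.
have BU : B1 `|` B2 = B by rewrite setUIDK.
have BI : B1 `&` B2 = set0 by rewrite /B2 setDE setIACA setICr setI0.
have B1E : B1 `<=` E by move=> t [/BE].
have B2E : B2 `<=` E by move=> t [/BE].
have BUE : B1 `|` B2 `<=` E by rewrite BU.
have := mD _ _ mB1 mB2 BUE BI; have := kD _ _ mB1 mB2 BUE BI; rewrite BU => kU mU.
have ws2 t : B2 t -> w t \in r.
  by move=> [/ws' + wy]; rewrite in_cons => /orP[/eqP /wy|].
(* The fibre of [y] is discarded if it is null or if [k] is positive on it. In the second case [k]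
   is negative on the rest, which therefore is not null. *)
have [kB1|kB1] := leP (k B1) 0; have [mB10|mB10] := eqVneq (m B1) 0.
- by have kB10 := k0 _ mB1 B1E mB10; apply: (IH B2) => //; lra.
- exists B1, y; split=> //; first by move=> t [].
  by rewrite lt_neqAle eq_sym mB10 m0.
- by rewrite (k0 _ mB1)// ltxx in kB1.
- apply: (IH B2) => //; last lra.
  rewrite lt_neqAle m0 andbT eq_sym; apply/negP => /eqP mB20.
  by move: kU; rewrite (k0 B2)//; lra.
Qed.

(** * From [L1] to [X]: localisation to a cell *)

Section Localization.
Context d (T : measurableType d) (R : realType) (X : normedModType R).
Variable mu : {measure set T -> \bar R}.
Implicit Types (B E : set T) (f : T -> X).

Local Notation L1 := (@bochner_integrable d T R X mu).
Local Notation N := (@L1norm d T R X mu).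
Local Notation cut := (@cutoff d T R X).

(** At most one of the two terms is nonzero. The map [g] will be the identity, for sums of
    functions, and the norm, for [L1norm]. *)
Lemma comp_cutoffU (V : zmodType) (g : X -> V) B B' f t : g 0 = 0 ->
  B `&` B' = set0 ->
  g (cut (B `|` B') f t) = g (cut B f t) + g (cut B' f t).
Proof.
move=> g0 BB'; rewrite /cutoff in_setU.
have [tB|tB] := boolP (t \in B); have [tB'|tB'] := boolP (t \in B');
  rewrite /= ?g0 ?addr0 ?add0r//.
have : (B `&` B') t by split; exact: set_mem.
by rewrite BB'.
Qed.

Lemma cutoffU B B' f : B `&` B' = set0 ->
  cut (B `|` B') f = cut B f + cut B' f.
Proof. by move=> BB'; apply/funext => t; exact: (@comp_cutoffU _ id). Qed.

Lemma L1norm_cutoffU B B' f : measurable B -> measurable B' ->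
  B `&` B' = set0 -> L1 f -> N (cut (B `|` B') f) = N (cut B f) + N (cut B' f).
Proof.
move=> mB mB' BB' fL; rewrite !L1normE -RintegralD//.
- by apply: eq_Rintegral => t _; apply: (@comp_cutoffU _ Num.norm); rewrite ?normr0.
- exact/bochner_integrable_norm/bochner_cutoff.
- exact/bochner_integrable_norm/bochner_cutoff.
Qed.

Lemma bochner_cutoff_cst B x : measurable B -> (mu B < +oo)%E -> L1 (cut B (fun=> x)).
Proof.
move=> mB Boo; apply: (@bochner_integrableP _ _ _ _ _ _ (fun t => `|x| * \1_B t)).
- by apply/strongly_measurable_cutoff/fin_valued_strongly_measurable/fin_valued_cst.
- apply: (@integrableZl _ _ _ _ _ measurableT `|x| (EFin \o \1_B)).
  apply/integrableP; split; first exact/measurable_EFinP/measurable_indic.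
  under eq_integral do rewrite /= ger0_norm//.
  by rewrite integral_indic// setIT.
- by move=> t; rewrite /cutoff indicE; case: (t \in B); rewrite ?normr0 ?mulr1 ?mulr0.
Qed.

Lemma L1norm_cutoff_cst B x : measurable B -> (mu B < +oo)%E ->
  N (cut B (fun=> x)) = `|x| * fine (mu B).
Proof.
move=> mB Boo; rewrite L1normE -(Rintegral_cst mu mB) [RHS]Rintegral_mkcond.
apply: eq_Rintegral => t _; rewrite /cutoff patchE.
by case: ifP => //; rewrite normr0.
Qed.

Lemma L1norm_cutoff_null B f : measurable B -> mu B = 0%E -> L1 f ->
  N (cut B f) = 0.
Proof.
move=> mB B0 fL; rewrite L1normE (@eq_Rintegral _ _ _ _ _ ((fun t => `|f t|) \_ B)).
  rewrite -Rintegral_mkcond /Rintegral null_set_integral//.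
  by apply: measurable_funTS; apply/measurable_EFinP/measurable_strong_norm; case: fL.
by move=> t _; rewrite /cutoff patchE; case: ifP => //; rewrite normr0.
Qed.

Lemma cutoff_eq B f g : (forall t, B t -> f t = g t) -> cut B f = cut B g.
Proof.
move=> fg; apply/funext => t; rewrite /cutoff.
by case: ifPn => // /set_mem /fg.
Qed.

Lemma L1_splits_pointwise (x1 x2 : X) E (s : R) : L1_prop_starstar X mu ->
  measurable E -> (0 < mu E)%E -> (mu E < +oo)%E -> 0 < s ->
  exists (phi : X -> R) (y : X), [/\ dual_ball setT (fun x => `|x|) phi,
    `|y| <= `|x2| + s, `|x1| - phi x1 <= s, `|y| - phi y <= s &
    `|y - x2| - phi (y - x2) <= s].
Proof.
move=> PL mE E0 Eoo s0; have sn := bochner_seminormed X mu.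
pose m B := fine (mu B).
have M0 : 0 < m E by rewrite fine_gt0// E0.
(* [c] dominates [|x1|] and [|x2| + 4], the factors of [e * m E] in the errors; the 4 comes from
   replacing [u0] by the simple [u]. *)
pose c := `|x1| + `|x2| + 4.
have c0 : 0 < c by rewrite /c; have := normr_ge0 x1; have := normr_ge0 x2; lra.
(* With this weight, [C * r <= |x2| + s] means [r <= s]. *)
pose C := (s + `|x2|) / s.
have C0 : 0 < C by rewrite divr_gt0//; have := normr_ge0 x2; lra.
(* Chosen so that [tol + C * (3 * tol) = s * m E], which gives [k E <= 0]. *)
pose e := s / (c * (1 + 3 * C)).
have e0 : 0 < e by rewrite divr_gt0// mulr_gt0//; lra.
pose f1 := cut E (fun=> x1); pose f2 := cut E (fun=> x2).
have Lf1 : L1 f1 by exact: bochner_cutoff_cst.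
have Lf2 : L1 f2 by exact: bochner_cutoff_cst.
have [F [u0 [Fb sp0]]] := starstar_splits_rel sn PL Lf1 Lf2 e0.
have Lu0 : L1 u0 by case: sp0.
have eM0 : 0 < e * m E by rewrite mulr_gt0.
have [u [us Lu u0u]] := bochner_simple_dense Lu0 eM0.
rewrite (seminorm_distC sn)// in u0u.
pose D f := N f - F f; pose tol := e * m E * c.
have [Df1 Nu Du Dc] : [/\ D f1 <= tol, N u <= `|x2| * m E + tol, D u <= tol &
    D (u - f2) <= tol].
  have sp : splits L1 N F f1 f2 u (e * N f1) (e * N f2 + 4 * (e * m E)).
    have f10 : N (f1 - f1) <= 0 by rewrite subrr (seminorm0 sn).
    have f20 : N (f2 - f2) <= e * m E by rewrite subrr (seminorm0 sn) ltW.
    have := splits_near sn Fb Lf1 Lf2 Lf1 Lf2 Lu sp0 f10 f20 u0u.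
    by rewrite mulr0 addr0.
  rewrite !L1norm_cutoff_cst// -/(m E) in sp.
  have ? : 0 <= e * m E * `|x1| by rewrite mulr_ge0// ltW.
  have ? : 0 <= e * m E * `|x2| by rewrite mulr_ge0// ltW.
  have [_ D1 [Nu _] Du Dc] := sp.
  by rewrite /tol /c /D; rewrite !L1norm_cutoff_cst// -/(m E) in Nu D1 *;
    split; lra.
have FD f g : L1 f -> L1 g -> F (f + g) = F f + F g by exact: (dual_ballD Fb).
have Dge0 f : L1 f -> 0 <= D f.
  by move=> Lf; rewrite subr_ge0 (dual_ball_le Fb).
have DU B B' f : measurable B -> measurable B' -> B `&` B' = set0 -> L1 f ->
    D (cut (B `|` B') f) = D (cut B f) + D (cut B' f).
  move=> mB mB' BB' Lf; rewrite /D L1norm_cutoffU// cutoffU// FD; first by ring.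
    exact: bochner_cutoff.
  exact: bochner_cutoff.
have cutT f : cut setT f = f.
  by apply/funext => t; rewrite /cutoff mem_set.
have DE f : L1 f -> D (cut E f) <= D f.
  move=> Lf; rewrite -{2}[f]cutT -(setUv E) DU ?setICr//; last exact: measurableC.
  by rewrite lerDl Dge0//; apply: bochner_cutoff => //; exact: measurableC.
have Boo B : measurable B -> B `<=` E -> (mu B < +oo)%E.
  by move=> mB BE; apply: le_lt_trans Eoo; apply: le_measure => //; rewrite inE.
have Luf2 : L1 (u - f2) by exact: (subspaceB sn).
(* Since [`|y| >= 0], a large weight [C] on the defects lets a single cell with
   [k B <= 0] control the norm and all three defects at once. *)
pose k B := N (cut B u) - `|x2| * m B +
  C * (D (cut B f1) + D (cut B u) + D (cut B (u - f2))) - s * m B.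
have mU B B' : measurable B -> measurable B' -> B `|` B' `<=` E ->
    B `&` B' = set0 -> m (B `|` B') = m B + m B'.
  move=> mB mB' BE BB'; rewrite /m measureU// fineD// ge0_fin_numE//;
    apply: Boo => // t ?; apply: BE; by [left|right].
have [] := @finite_partition_pigeonhole _ _ R X u E m k us mE.
- by move=> B; exact: fine_ge0.
- by rewrite /m measure0.
- exact: mU.
- move=> B B' mB mB' BE BB'.
  by rewrite /k mU// L1norm_cutoffU// !DU//; ring.
- move=> B mB BE mB0.
  (* [fine] sends an infinite measure to 0 as well, so finiteness inside [E] is what recovers
     [mu B = 0]. *)
  have muB0 : mu B = 0%E.
    by rewrite -[LHS]fineK ?ge0_fin_numE ?Boo// -/(m B) mB0.
  have cut0 f : L1 f -> N (cut B f) = 0 by exact: L1norm_cutoff_null.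
  have D0 f : L1 f -> D (cut B f) = 0.
    move=> Lf; have Lc : L1 (cut B f) by exact: bochner_cutoff.
    have := dual_ball_le Fb Lc; have := dual_ball_ge Fb Lc.
    by rewrite /D cut0//; lra.
  by rewrite /k cut0// !D0// mB0; ring.
- exact: M0.
- have : N (cut E u) <= N u.
    apply: L1norm_le => //; first exact: bochner_cutoff.
    by move=> t; exact: norm_cutoff_le.
  have : C * (D (cut E f1) + D (cut E u) + D (cut E (u - f2))) <= C * (3 * tol).
    rewrite ler_pM2l//; have := DE _ Lf1; have := DE _ Lu; have := DE _ Luf2; lra.
  have : tol + C * (3 * tol) = s * m E.
    rewrite /tol /e; field; apply/andP; split; rewrite gt_eqF//; lra.
  rewrite /k; lra.
move=> B [y [mB BE uy mB0 kB]].
have Bfin := Boo B mB BE.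
(* Restricting [F] to constants on [B] and dividing by [m B] rescales defects, so [k B <= 0] becomes
   an inequality between vectors of [X]. *)
pose phi x := F (cut B (fun=> x)) / m B.
have LB x : L1 (cut B (fun=> x)) by exact: bochner_cutoff_cst.
have Dphi x : D (cut B (fun=> x)) = m B * (`|x| - phi x).
  rewrite /D L1norm_cutoff_cst// -/(m B) /phi; field.
  by rewrite gt_eqF.
have phib : dual_ball setT (fun x => `|x|) phi.
  split=> [a x z _ _|x _].
    have -> : phi (a *: x + z) = F (a *: cut B (fun=> x) + cut B (fun=> z)) / m B.
      congr (F _ / _); apply/funext => t; rewrite /cutoff /=.
      by rewrite /GRing.scale/= /GRing.add /=; case: ifP => // _; rewrite scaler0 addr0.
    by have [-> //] := Fb; rewrite /phi mulrDl mulrA.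
  rewrite /phi normrM normfV (gtr0_norm mB0) ler_pdivrMr//.
  rewrite -(L1norm_cutoff_cst x mB Bfin).
  by have [_] := Fb; apply.
have Bf2 t : B t -> f2 t = x2 by move=> /BE Et; rewrite /f2 /cutoff mem_set.
have E1 : cut B f1 = cut B (fun=> x1).
  by apply: cutoff_eq => t /BE Et; rewrite /f1 /cutoff mem_set.
have E2 : cut B u = cut B (fun=> y) by exact: cutoff_eq.
have E3 : cut B (u - f2) = cut B (fun=> y - x2).
  by apply: cutoff_eq => t Bt; rewrite -(Bf2 t Bt) -(uy t Bt).
move: kB; rewrite /k E1 E2 E3 !Dphi L1norm_cutoff_cst// -/(m B).
set d1 := `|x1| - phi x1; set d2 := `|y| - phi y; set d3 := `|y - x2| - phi (y - x2).
have dge0 x : 0 <= `|x| - phi x.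
  by rewrite subr_ge0; have := dual_ball_le phib (I : setT x).
have d10 : 0 <= d1 := dge0 x1.
have d20 : 0 <= d2 := dge0 y.
have d30 : 0 <= d3 := dge0 (y - x2).
move=> kB.
have {}kB : `|y| + C * (d1 + d2 + d3) <= `|x2| + s.
  rewrite -(ler_pM2l mB0); lra.
have small r : 0 <= r -> r <= d1 + d2 + d3 -> r <= s.
  move=> r0 rd; have : C * r <= `|x2| + s.
    have : C * r <= C * (d1 + d2 + d3) by rewrite ler_pM2l.
    by have := normr_ge0 y; lra.
  rewrite -ler_pdivlMl//; move=> /le_trans; apply.
  by rewrite [`|x2| + s]addrC /C invf_div divfK// gt_eqF//; have := normr_ge0 x2; lra.
exists phi, y; split=> //;
  [|by apply: (small d1 d10); lra|by apply: (small d2 d20); lra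
  |by apply: (small d3 d30); lra].
have : 0 <= C * (d1 + d2 + d3) by rewrite mulr_ge0 ?(ltW C0)//; lra.
by lra.
Qed.

(* The hypothesis on [tau] forces [phi x2 >= - s / tau] for every functional
   [phi] that is [s]-norming at [x1], which bounds [|y - x2|] once [|y|] is
   bounded. *)
Lemma L1_splits_oriented (x1 x2 : X) E (tau e : R) : L1_prop_starstar X mu ->
  measurable E -> (0 < mu E)%E -> (mu E < +oo)%E -> 0 < e -> 0 < tau ->
  `|x1 - tau *: x2| <= `|x1| ->
  exists (phi : X -> R) (y : X), dual_ball setT (fun x => `|x|) phi /\
    splits setT (fun x => `|x|) phi x1 x2 y e e.
Proof.
move=> PL mE E0 Eoo e0 tau0 tauP; have sn := normed_seminormed X.
(* The second bound gives [phi x2 >= - e / 4]; then [|y - x2| <= phi y - phi x2 + s <= |x2| + 2 * s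
   + e / 4], and the first bound keeps this below [|x2| + e]. *)
pose s := Num.min (e / 4) (e / 4 * tau).
have s0 : 0 < s.
  by rewrite lt_min; apply/andP; split; rewrite ?mulr_gt0//; lra.
have [se st] : s <= e / 4 /\ s <= e / 4 * tau.
  by split; rewrite ge_min lexx// orbT.
have [phi [y [phib Ny D1 Dy Dc]]] := L1_splits_pointwise x1 x2 PL mE E0 Eoo s0.
(* [tau * phi x2 = phi x1 - phi (x1 - tau *: x2)] is at least [(|x1| - s) - |x1|]. *)
have phi2 : - (e / 4) <= phi x2.
  rewrite -(ler_pM2l tau0) -(dual_ballZ sn phib)//.
  have := dual_ball_le phib (I : setT (x1 - tau *: x2)).
  by rewrite (dual_ballB sn phib)//; lra.
have := dual_ball_le phib (I : setT y).
exists phi, y; split=> //.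
rewrite /splits; move: Dc; rewrite (dual_ballB sn phib)// => Dc.
by split=> //; [|split|..]; lra.
Qed.

Lemma starstar_of_L1 : sigma_finite setT mu -> (0 < mu setT)%E ->
  L1_prop_starstar X mu -> normed_prop_starstar X.
Proof.
move=> [A AT AP] mu0 PL.
(* A countable cover by null sets would make [mu setT] vanish. *)
have [n An0] : exists n, (0 < mu (A n))%E.
  apply/not_existsP => An; suff : (mu setT <= 0)%E by rewrite leNgt mu0.
  rewrite AT; apply: le_trans (measure_sigma_subadditive _ _ _ (@subset_refl _ _)) _.
  - by move=> i; case: (AP i).
  - by apply: bigcup_measurable => i _; case: (AP i).
  - by rewrite eseries0// => i _ _; apply/eqP; rewrite eq_le measure_ge0 andbT leNgt; apply/negP/An.
have [mA Aoo] := AP n.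
have sn := normed_seminormed X.
apply: (splits_starstar sn) => z1 z2 e [_ Nz1] [_ Nz2] e0.
have e4 : 0 < e / 4 by lra.
(* In the first case [z1 + e / 4 *: z2] is used with tolerance [e / 2], and moving back to [z1]
   costs another [2 * (e / 4)]. *)
have [z12|z12] := leP `|z1| `|z1 + e / 4 *: z2|.
  have tauP : `|(z1 + e / 4 *: z2) - e / 4 *: z2| <= `|z1 + e / 4 *: z2|.
    by rewrite addrK.
  have [phi [y [phib sp]]] := L1_splits_oriented PL mA An0 Aoo (divr_gt0 e0 (ltr0n R 2)) e4 tauP.
  exists phi, y; split=> //.
  have d1 : `|z1 - (z1 + e / 4 *: z2)| <= e / 4.
    by rewrite opprD addNKr normrN normrZ Nz2 mulr1 gtr0_norm.
  have zero (x : X) : `|x - x| <= 0 :> R by rewrite subrr normr0.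
  have := splits_near sn phib I I I I I sp d1 (zero z2) (zero y).
  by move=> /splits_weaken; apply; lra.
(* In the second case [z1] is kept, [z2] is replaced by [- z2], and the two parts are exchanged
   afterwards. *)
have tauP : `|z1 - e / 4 *: (- z2)| <= `|z1| by rewrite scalerN opprK ltW.
have [phi [y [phib sp]]] := L1_splits_oriented PL mA An0 Aoo e0 e4 tauP.
by exists phi, (y - - z2); split=> //; rewrite -[X in splits _ _ _ _ X]opprK;
  exact: (splits_opp sn).
Qed.

End Localization.

Theorem theorem2p7 (R : realType) (X : completeNormedModType R)
  (d : measure_display) (T : measurableType d)
  (mu : {measure set T -> \bar R}) :
  sigma_finite setT mu -> (0 < mu setT)%E ->
  (normed_prop_starstar X <-> L1_prop_starstar X mu).
Proof.
by move=> mus mu0; split; [exact: starstar_L1|exact: starstar_of_L1].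
Qed.
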